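(* For all integers $\alpha,\beta\geq 0$, one has the identity of formal power series in $q$ $${\alpha+\beta\choose \alpha}_q=\frac{1}{1-q^{\alpha+\beta+1}}\left(\sum_{i=0}^\infty q^{i(\beta+1)}\prod_{j=i+1}^{i+\alpha}(1-q^j)\right)^{-1}.$$
   Context: For integers $\alpha,\beta\geq 0$ the $q$-binomial is $${\alpha+\beta\choose \alpha}_q=\frac{\prod_{j=1}^{\alpha+\beta}(q^j-1)}{\prod_{j=1}^{\alpha}(q^j-1)\prod_{j=1}^{\beta}(q^j-1)},$$ a polynomial in $q$. Empty products equal $1$. *)

(* Defs.v *)
From HB Require Import structures.
From mathcomp Require Import all_boot all_algebra.
From mathcomp Require Import boolp classical_sets.
From mathcomp Require Import ring.

Set Implicit Arguments.
Unset Strict Implicit.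
Unset Printing Implicit Defensive.

Import GRing.Theory.
Local Open Scope ring_scope.

(* {fps R} is R[[q]], built as a ring because the libraries have no formal
   power series.  It is a record rather than an alias of nat -> R, since
   functions already carry a pointwise product. *)
Record fps (R : Type) := Fps { fps_coef : nat -> R }.

Notation "{ 'fps' R }" := (fps R) (at level 0, format "{ 'fps'  R }").

HB.instance Definition _ (R : Type) := gen_eqMixin {fps R}.
HB.instance Definition _ (R : Type) := gen_choiceMixin {fps R}.

Lemma fpsP (R : Type) (f g : {fps R}) :
  (forall n, fps_coef f n = fps_coef g n) <-> f = g.
Proof.
split=> [|-> //]; case: f g => [f] [g] /= fg.
by congr Fps; apply/funext.
Qed.

Section FpsZmodule.
Variable R : zmodType.
Implicit Types f g h : {fps R}.

Definition fps_zero : {fps R} := Fps (fun=> 0).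
Definition fps_opp f := Fps (fun n => - fps_coef f n).
Definition fps_add f g := Fps (fun n => fps_coef f n + fps_coef g n).

Fact fps_addA : associative fps_add.
Proof. by move=> f g h; apply/fpsP => n /=; rewrite addrA. Qed.

Fact fps_addC : commutative fps_add.
Proof. by move=> f g; apply/fpsP => n /=; rewrite addrC. Qed.

Fact fps_add0 : left_id fps_zero fps_add.
Proof. by move=> f; apply/fpsP => n /=; rewrite add0r. Qed.

Fact fps_addN : left_inverse fps_zero fps_opp fps_add.
Proof. by move=> f; apply/fpsP => n /=; rewrite addNr. Qed.

HB.instance Definition _ :=
  GRing.isZmodule.Build {fps R} fps_addA fps_addC fps_add0 fps_addN.

Lemma fps_coefD f g n : fps_coef (f + g) n = fps_coef f n + fps_coef g n.
Proof. by []. Qed.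

Lemma fps_coefN f n : fps_coef (- f) n = - fps_coef f n.
Proof. by []. Qed.

Lemma fps_coef0 n : fps_coef (0 : {fps R}) n = 0.
Proof. by []. Qed.

Lemma fps_coef_sum (I : Type) (r : seq I) (P : pred I) (F : I -> {fps R}) n :
  fps_coef (\sum_(i <- r | P i) F i) n = \sum_(i <- r | P i) fps_coef (F i) n.
Proof. by apply: (big_morph (fun f => fps_coef f n)). Qed.

(* The sum of a series of power series, for the q-adic topology: each
   coefficient of the partial sums is eventually constant. *)
Definition fps_has_sum (F : nat -> {fps R}) (S : {fps R}) : Prop :=
  forall n, exists N, forall m, (N <= m)%N ->
    fps_coef (\sum_(0 <= i < m) F i) n = fps_coef S n.

Lemma fps_has_sum_unique F S T : fps_has_sum F S -> fps_has_sum F T -> S = T.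
Proof.
move=> FS FT; apply/fpsP => n.
have [[N FSN] [M FTM]] := (FS n, FT n).
by rewrite -(FSN (maxn N M)) ?leq_maxl // FTM ?leq_maxr.
Qed.

(* Equal to 0 when F is not summable. *)
Definition fps_sum (F : nat -> {fps R}) : {fps R} :=
  xget 0 [set S | fps_has_sum F S]%classic.

Lemma fps_sumE F S : fps_has_sum F S -> fps_sum F = S.
Proof.
move=> FS; apply: (fps_has_sum_unique _ FS).
by apply: (@xgetPex _ _ [set T | fps_has_sum F T]%classic); exists S.
Qed.

End FpsZmodule.

Section FpsRing.
Variable R : comNzRingType.
Implicit Types f g h : {fps R}.

Definition fps_of_poly (p : {poly R}) : {fps R} := Fps (fun n => p`_n).

Definition fps_one : {fps R} := fps_of_poly 1.
Definition fps_mul f g :=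
  Fps (fun n => \sum_(i < n.+1) fps_coef f i * fps_coef g (n - i)).

Definition fps_trunc N f : {poly R} := \poly_(i < N) fps_coef f i.

Fact fps_coef_trunc N f n : (n < N)%N -> (fps_trunc N f)`_n = fps_coef f n.
Proof. by move=> nN; rewrite coef_poly nN. Qed.

Fact fps_mul_poly f g (p r : {poly R}) n :
    (forall k, (k <= n)%N -> p`_k = fps_coef f k) ->
    (forall k, (k <= n)%N -> r`_k = fps_coef g k) ->
  fps_coef (fps_mul f g) n = (p * r)`_n.
Proof.
move=> pf rg; rewrite coefM; apply: eq_bigr => i _ /=.
by rewrite pf ?rg ?leq_subr // -ltnS.
Qed.

Fact fps_mulA : associative fps_mul.
Proof.
move=> f g h; apply/fpsP => n.
pose t := fps_trunc n.+1.
have tE u k : (k <= n)%N -> (t u)`_k = fps_coef u k.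
  by rewrite -ltnS; apply: fps_coef_trunc.
have tM u v k : (k <= n)%N -> (t u * t v)`_k = fps_coef (fps_mul u v) k.
  by move=> kn; apply/esym/fps_mul_poly => j jk; apply: tE; apply: leq_trans kn.
rewrite (@fps_mul_poly f _ (t f) (t g * t h)) ?mulrA //.
- by rewrite (@fps_mul_poly _ h (t f * t g) (t h)) // => k; [apply: tM | apply: tE].
- by move=> k; apply: tE.
- by move=> k; apply: tM.
Qed.

Fact fps_mulC : commutative fps_mul.
Proof.
move=> f g; apply/fpsP => n.
have tE u k : (k <= n)%N -> (fps_trunc n.+1 u)`_k = fps_coef u k.
  by rewrite -ltnS; apply: fps_coef_trunc.
by rewrite !(fps_mul_poly (tE _) (tE _)) mulrC.
Qed.

Fact fps_mul1 : left_id fps_one fps_mul.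
Proof.
move=> f; apply/fpsP => n; have tE k := @fps_coef_trunc n.+1 f k.
by rewrite (@fps_mul_poly _ _ 1 _ n _ tE) // mul1r tE.
Qed.

Fact fps_mulDl : left_distributive fps_mul (@fps_add R).
Proof.
move=> f g h; apply/fpsP => n /=; rewrite -big_split.
by apply: eq_bigr => i _; rewrite mulrDl.
Qed.

Fact fps_one_neq0 : fps_one != 0.
Proof.
apply/eqP => /fpsP /(_ 0) /= /eqP.
by rewrite coef1 oner_eq0.
Qed.

HB.instance Definition _ := GRing.Zmodule_isComNzRing.Build {fps R}
  fps_mulA fps_mulC fps_mul1 fps_mulDl fps_one_neq0.

Lemma fps_coef1 n : fps_coef (1 : {fps R}) n = (n == 0)%:R.
Proof. exact: coef1. Qed.

Lemma fps_coefM f g n :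
  fps_coef (f * g) n = \sum_(i < n.+1) fps_coef f i * fps_coef g (n - i).
Proof. by []. Qed.

Fact fps_of_poly_is_zmod_morphism : zmod_morphism fps_of_poly.
Proof. by move=> p r; apply/fpsP => n /=; rewrite coefB. Qed.

Fact fps_of_poly_is_monoid_morphism : monoid_morphism fps_of_poly.
Proof. by split=> // p r; apply/fpsP => n; rewrite fps_coefM /= coefM. Qed.

HB.instance Definition _ := GRing.isZmodMorphism.Build {poly R} {fps R}
  fps_of_poly fps_of_poly_is_zmod_morphism.
HB.instance Definition _ := GRing.isMonoidMorphism.Build {poly R} {fps R}
  fps_of_poly fps_of_poly_is_monoid_morphism.

Definition fps_q : {fps R} := fps_of_poly 'X.

End FpsRing.

Arguments fps_q {R}.

Section FpsUnitRing.
Variable R : comUnitRingType.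
Implicit Types f g h : {fps R}.

Definition fps_unit : pred {fps R} := [pred f | fps_coef f 0 \is a GRing.unit].

(* The first n coefficients of 1 / f, from
   \sum_(i <= m) f_(m - i) (1 / f)_i = [m = 0]. *)
Fixpoint fps_inv_seq f n : seq R :=
  if n is m.+1 then
    let s := fps_inv_seq f m in
    rcons s ((fps_coef f 0)^-1 *
             ((m == 0)%:R - \sum_(i < m) fps_coef f (m - i) * s`_i))
  else [::].

Definition fps_inv f : {fps R} :=
  if fps_unit f then Fps (fun n => (fps_inv_seq f n.+1)`_n) else f.

Fact size_fps_inv_seq f n : size (fps_inv_seq f n) = n.
Proof. by elim: n => //= n IHn; rewrite size_rcons IHn. Qed.

Fact nth_fps_inv_seq f n k :
  (k < n)%N -> (fps_inv_seq f n)`_k = (fps_inv_seq f k.+1)`_k.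
Proof.
elim: n => // n IHn; rewrite ltnS leq_eqVlt => /predU1P[-> //|kn].
by rewrite [LHS]/= nth_rcons size_fps_inv_seq kn IHn.
Qed.

Fact fps_mulV : {in fps_unit, left_inverse 1 fps_inv *%R}.
Proof.
move=> f Uf; rewrite mulrC; apply/fpsP => n.
rewrite fps_coefM fps_coef1 /fps_inv [fps_unit f]Uf.
rewrite (reindex_inj rev_ord_inj) big_ord_recr /= subSS subnn subn0.
rewrite nth_rcons size_fps_inv_seq ltnn eqxx mulVKr //.
set S := (X in X + _); set T := \sum_(i < n) _.
suff -> : S = T by rewrite addrC subrK.
apply: eq_bigr => i _ /=; have le_in := ltnW (ltn_ord i).
rewrite subSS subKn //; congr (_ * _).
by rewrite (nth_fps_inv_seq f (ltn_ord i)).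
Qed.

Fact fps_unitPl f g : g * f = 1 -> fps_unit f.
Proof.
move/fpsP/(_ 0); rewrite fps_coefM fps_coef1 big_ord1 /= => gf1.
by apply/unitrPr; exists (fps_coef g 0); rewrite mulrC.
Qed.

Fact fps_invr_out : {in [predC fps_unit], fps_inv =1 id}.
Proof. by move=> f /negPf Uf; rewrite /fps_inv [fps_unit f]Uf. Qed.

HB.instance Definition _ := GRing.ComNzRing_hasMulInverse.Build {fps R}
  fps_mulV fps_unitPl fps_invr_out.

Lemma fps_unitE f :
  (f \is a GRing.unit) = (fps_coef f 0 \is a GRing.unit).
Proof. by []. Qed.

End FpsUnitRing.

(* \prod_(j = 1 .. n) (q ^ j - 1), a monic polynomial in q = 'X. *)
Definition qprod (n : nat) : {poly int} := \prod_(1 <= j < n.+1) ('X^j - 1).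

(* The q-binomial of a + b over a.  For a monic divisor, %/ is the quotient of
   the Euclidean division in {poly int}; qbinomE shows that it is exact. *)
Definition qbinom (a b : nat) : {poly int} :=
  qprod (a + b) %/ (qprod a * qprod b).

Lemma qprodS n : qprod n.+1 = qprod n * ('X^(n.+1) - 1).
Proof. by rewrite /qprod big_nat_recr. Qed.

Lemma qprod_monic n : qprod n \is monic.
Proof.
elim: n => [|n IHn]; first by rewrite /qprod big_geq // monic1.
by rewrite qprodS monicMl // -polyC1 monicXnsubC.
Qed.

Lemma qprod_dvd a b :
  exists G, qprod (a + b) = G * (qprod a * qprod b).
Proof.
have q0 : qprod 0 = 1 by rewrite /qprod big_geq.
have [n le_n] := ubnP (a + b); elim: n a b le_n => // n IHn [|a] [|b] le_n;
  try by exists 1; rewrite ?addn0 ?add0n q0 ?mul1r ?mulr1.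
have [|G1 E1] := IHn a b.+1; first by rewrite -ltnS -addSn.
have [|G2 E2] := IHn a.+1 b; first by rewrite -ltnS -addnS.
exists ('X^(b.+1) * G1 + G2).
have -> : qprod (a.+1 + b.+1) = qprod (a + b.+1) * ('X^(b.+1 + a.+1) - 1).
  by rewrite addSn qprodS -addSn (addnC a.+1).
have -> : 'X^(b.+1 + a.+1) - 1 =
          'X^(b.+1) * ('X^(a.+1) - 1) + ('X^(b.+1) - 1) :> {poly int}.
  by rewrite exprD mulrBr mulr1 addrA subrK.
rewrite mulrDr {1}E1 -addSnnS E2 !qprodS.
by move: ('X^(a.+1)) ('X^(b.+1)) => x y; ring.
Qed.

Lemma qbinomE a b : qbinom a b * (qprod a * qprod b) = qprod (a + b).
Proof.
rewrite /qbinom; have [G ->] := qprod_dvd a b.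
by rewrite Pdiv.IdomainMonic.mulpK // monicMl ?qprod_monic.
Qed.

(* Main.v *)
Require Import Defs.
From mathcomp Require Import all_boot all_algebra.
From mathcomp Require Import boolp ring.

Import GRing.Theory.
Local Open Scope ring_scope.

(** Write (q)_n for the product of the 1 - q^j over 1 <= j <= n, and S(a, b)
    for the sum of the series of the theorem.  The point is the closed form
      S(a, b) = (q)_a (q)_b / (q)_(a+b+1),
    lemma [has_sum_qpoch_series].  It goes by induction on a, for all b at
    once.  For a = 0 the series is geometric of ratio q^(b+1).  Splitting the
    last factor 1 - q^(i+a+1) of the i-th term gives
      S(a+1, b) = S(a, b) - q^(a+1) S(a, b+1),
    and the closed form satisfies the same recurrence because
      (1 - q^(a+b+2)) - q^(a+1) (1 - q^(b+1)) = 1 - q^(a+1).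

    The q-binomial is (q)_(a+b) / ((q)_a (q)_b), since the signs in the factors
    q^j - 1 cancel ([qbinom_qpoch]).  Multiplying the two formulas leaves
    (q)_(a+b) / (q)_(a+b+1) = 1 / (1 - q^(a+b+1)).  All divisions are legitimate
    because every 1 - q^j with j > 0 has constant coefficient 1. *)

(** * Summable series of formal power series *)

Lemma fps_has_sumB (R : zmodType) (F G : nat -> {fps R}) (S T : {fps R}) :
  fps_has_sum F S -> fps_has_sum G T ->
  fps_has_sum (fun i => F i - G i) (S - T).
Proof.
move=> FS GT n; have [[N FSN] [M GTM]] := (FS n, GT n).
exists (maxn N M) => m; rewrite geq_max => /andP[Nm Mm].
by rewrite sumrB !fps_coefD !fps_coefN FSN // GTM.
Qed.

(** Coefficient n of a product involves the coefficients up to n of each factor,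
    and these stabilize simultaneously since there are finitely many of them. *)
Lemma fps_has_sumMl (R : comNzRingType) (f : {fps R}) (F : nat -> {fps R})
    (S : {fps R}) :
  fps_has_sum F S -> fps_has_sum (fun i => f * F i) (f * S).
Proof.
move=> /choice[N FSN] n; exists (\max_(k < n.+1) N k) => m Nm.
rewrite -mulr_sumr !fps_coefM; apply: eq_bigr => i _; congr (_ * _).
apply: FSN; apply: leq_trans Nm.
have lt_k : (n - i < n.+1)%N by rewrite ltnS leq_subr.
exact: (leq_bigmax (Ordinal lt_k)).
Qed.

Lemma fps_qX (R : comNzRingType) k :
  fps_q ^+ k = fps_of_poly 'X^k :> {fps R}.
Proof. by rewrite rmorphXn. Qed.

Lemma fps_coef_qXM (R : comNzRingType) (f : {fps R}) k n :
  (n < k)%N -> fps_coef (fps_q ^+ k * f) n = 0.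
Proof.
move=> lt_nk; rewrite fps_qX fps_coefM big1 // => i _ /=.
by rewrite coefXn ltn_eqF ?mul0r // (leq_trans (ltn_ord i)).
Qed.

Lemma fps_unit_1subqX (R : comUnitRingType) k :
  (0 < k)%N -> (1 - fps_q ^+ k : {fps R}) \is a GRing.unit.
Proof.
move=> k_gt0; rewrite fps_unitE fps_coefD fps_coefN fps_coef1.
by rewrite -[fps_q ^+ k]mulr1 fps_coef_qXM // subr0 unitr1.
Qed.

(** The partial sum of length m is (1 - q^(mk)) / (1 - q^k), and the error term
    q^(mk) / (1 - q^k) has no coefficient below mk. *)
Lemma fps_has_sum_geometric (R : comUnitRingType) k : (0 < k)%N ->
  fps_has_sum (fun i => fps_q ^+ (i * k) : {fps R}) (1 - fps_q ^+ k)^-1.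
Proof.
move=> k_gt0 n; exists n.+1 => m lt_nm; set V := _^-1.
have -> : \sum_(0 <= i < m) fps_q ^+ (i * k) = V - fps_q ^+ (m * k) * V.
  apply: (mulrI (fps_unit_1subqX R k k_gt0)).
  rewrite mulrBr [in RHS]mulrCA mulrV ?fps_unit_1subqX // mulr1.
  rewrite big_mkord; under eq_bigr do rewrite mulnC exprM.
  by rewrite mulnC exprM -opprB mulNr -subrX1 opprB.
rewrite fps_coefD fps_coefN fps_coef_qXM ?subr0 //.
by rewrite (leq_trans lt_nm) // leq_pmulr.
Qed.

(** * The q-Pochhammer symbol and the closed form of the series *)

Definition qpoch (R : comNzRingType) (n : nat) : {fps R} :=
  \prod_(1 <= j < n.+1) (1 - fps_q ^+ j).
Arguments qpoch {R} n.

Lemma qpoch0 (R : comNzRingType) : qpoch 0 = 1 :> {fps R}.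
Proof. by rewrite /qpoch big_geq. Qed.

Lemma qpochS (R : comNzRingType) n :
  qpoch n.+1 = qpoch n * (1 - fps_q ^+ n.+1) :> {fps R}.
Proof. by rewrite /qpoch big_nat_recr. Qed.

Lemma qpoch_unit (R : comUnitRingType) n :
  (qpoch n : {fps R}) \is a GRing.unit.
Proof.
elim: n => [|n IHn]; first by rewrite qpoch0 unitr1.
by rewrite qpochS unitrM IHn fps_unit_1subqX.
Qed.

(** The induction needs the closed form at a for two values of b, hence the
    quantification over b in the induction hypothesis. *)
Lemma has_sum_qpoch_series (R : comUnitRingType) (a b : nat) :
  fps_has_sum
    (fun i => fps_q ^+ (i * (b + 1)) *
      \prod_(i + 1 <= j < (i + a).+1) (1 - fps_q ^+ j) : {fps R})
    (qpoch a * qpoch b / qpoch (a + b).+1).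
Proof.
elim: a b => [|a IHa] b.
  rewrite qpoch0 mul1r add0n qpochS invrM ?qpoch_unit ?fps_unit_1subqX //.
  rewrite mulrCA mulrV ?qpoch_unit // mulr1.
  have := fps_has_sum_geometric R b.+1 isT; congr fps_has_sum.
  by apply/funext => i; rewrite big_geq ?mulr1 addn1 // addn0.
(* S(a+1, b) = S(a, b) - q^(a+1) S(a, b+1), first termwise, then on the closed
   forms, where the common denominator (q)_(a+b+2) is cleared. *)
have := fps_has_sumB _ _ _ _ _ (IHa b)
          (fps_has_sumMl _ (fps_q ^+ a.+1) _ _ (IHa b.+1)).
congr fps_has_sum.
  apply/funext => i; rewrite [in RHS]big_nat_recr /=; last first.
    by rewrite addn1 addnS ltnS leq_addr.
  rewrite !addn1 (mulnS i b.+1) !exprD [in RHS]addnS.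
  by move: (\prod_(_ <= j < _) _) => p; ring.
apply: (mulIr (qpoch_unit _ (a.+1 + b).+1)).
rewrite mulrVK ?qpoch_unit // mulrBl addSn addnS [in X in _ - X]mulrA.
rewrite (mulrVK (qpoch_unit _ _)) !(qpochS _ (a + b).+1) [in X in X - _]mulrA.
rewrite (mulrVK (qpoch_unit _ _)) !qpochS.
by rewrite -addnS -addSn exprD; ring.
Qed.

(** * The q-binomial *)

Lemma fps_of_qprod n : fps_of_poly (qprod n) = (-1) ^+ n * qpoch n.
Proof.
elim: n => [|n IHn]; first by rewrite /qprod big_geq // rmorph1 qpoch0 mulr1.
by rewrite qprodS qpochS rmorphM rmorphB rmorph1 /= IHn -fps_qX (exprS (-1)); ring.
Qed.

Lemma qbinom_qpoch a b :
  fps_of_poly (qbinom a b) * (qpoch a * qpoch b) = qpoch (a + b).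
Proof.
have := congr1 (@fps_of_poly int) (qbinomE a b).
rewrite !rmorphM /= !fps_of_qprod exprD => E.
have U : (-1) ^+ a * (-1) ^+ b \is a @GRing.unit {fps int}.
  by rewrite unitrM !unitrX ?unitrN1.
by apply: (mulrI U); rewrite -E; ring.
Qed.

Theorem proposition1p2 (a b : nat) :
  let F := fun i : nat =>
    fps_q ^+ (i * (b + 1)) *
      \prod_(i + 1 <= j < (i + a).+1) (1 - fps_q ^+ j) : {fps int} in
  [/\ fps_has_sum F (fps_sum F),
      fps_sum F \is a GRing.unit,
      1 - fps_q ^+ (a + b + 1) \is a @GRing.unit {fps int} &
      fps_of_poly (qbinom a b) =
        1 / (1 - fps_q ^+ (a + b + 1)) * (fps_sum F)^-1].
Proof.
move=> F; have FS := has_sum_qpoch_series int a b.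
have sumF := fps_sumE FS; rewrite -/F in FS sumF.
have U n := qpoch_unit int n.
have US : fps_sum F \is a GRing.unit by rewrite sumF !unitrM unitrV !U.
have U1 : 1 - fps_q ^+ (a + b + 1) \is a @GRing.unit {fps int}.
  by rewrite fps_unit_1subqX // addn1.
split=> //; first by rewrite sumF.
apply: (mulIr US); rewrite mulrVK // sumF mulrA qbinom_qpoch qpochS -addn1.
by rewrite invrM // mulrCA mulrV // mulr1 mul1r.
Qed.
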